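(* Let $\mathcal{A}$ be a free arrangement in $V=\mathbb{K}^\ell$ with $\exp(\mathcal{A})=(d_1,\ldots,d_\ell)$, and let $H\in\mathcal{A}$. Then $\mathcal{A}':=\mathcal{A}\setminus\{H\}$ is either free, or strictly plus-one generated with exponents $\mathrm{POexp}(\mathcal{A}')=(d_1,\ldots,d_\ell)$ and level $d=|\mathcal{A}'|-|\mathcal{A}^H|$.
   Context: Let $\mathbb{K}$ be a field, $V=\mathbb{K}^\ell$, $S=\mathrm{Sym}^*(V^* )=\mathbb{K}[x_1,\ldots,x_\ell]$ and $\mathrm{Der}\,S=\bigoplus_{i=1}^\ell S\partial_{x_i}$. An arrangement $\mathcal{A}$ in $V$ is a finite set of linear hyperplanes in $V$; arrangements are assumed essential ($\bigcap_{H\in\mathcal{A}}H=\{0\}$) unless otherwise specified. For $H\in\mathcal{A}$ fix $\alpha_H\in V^*$ with $\ker\alpha_H=H$, and let $\mathcal{A}^H:=\{L\cap H\mid L\in\mathcal{A}\setminus\{H\}\}$ be the restriction, an arrangement in $H$. The logarithmic derivation module is $D(\mathcal{A}):=\{\theta\in\mathrm{Der}\,S\mid\theta(\alpha_H)\in S\alpha_H\ (\forall H\in\mathcal{A})\}$. A derivation $\sum f_i\partial_{x_i}$ is homogeneous of degree $d$ if all $f_i$ lie in the degree-$d$ part $S_d$ of $S$; $D(\mathcal{A})$ is graded by this degree. $\mathcal{A}$ is free with exponents $\exp(\mathcal{A})=(d_1,\ldots,d_\ell)$ if $D(\mathcal{A})=\bigoplus_{i=1}^\ell S\theta_i$ with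 $\theta_i$ homogeneous of degree $d_i$. The order of exponents is immaterial. $\theta_E=\sum_i x_i\partial_{x_i}\in D(\mathcal{A})$ is the Euler derivation. $\mathcal{A}$ is plus-one generated with exponents $\mathrm{POexp}(\mathcal{A})=(d_1,\ldots,d_\ell)$ and level $d$ if $D(\mathcal{A})$ has a minimal (graded) free resolution of the form $$0\to S[-d-1]\xrightarrow{(\alpha,f_1,\ldots,f_\ell)}S[-d]\oplus\Big(\bigoplus_{i=1}^\ell S[-d_i]\Big)\to D(\mathcal{A})\to0.$$ Equivalently, there is a minimal set of homogeneous generators $\theta_1=\theta_E,\theta_2,\ldots,\theta_\ell,\varphi$ of $D(\mathcal{A})$ with $\deg\theta_i=d_i$ (so $d_1=1$), $\deg\varphi=d$, whose only relation (up to multiples) is $\sum_{i=1}^\ell f_i\theta_i+\alpha\varphi=0$ with $f_i\in S$, $\alpha\in V^*$. It is strictly plus-one generated (with the same exponents and level) if such a resolution can be chosen with $\alpha\neq0$. *)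

(* Defs.v *)
From mathcomp Require Import all_boot all_order all_algebra.
From mathcomp Require Import finmap mpoly.

Set Implicit Arguments.
Unset Strict Implicit.
Unset Printing Implicit Defensive.

Import GRing.Theory.
Local Open Scope ring_scope.

Section Arrangements.
Variables (K : fieldType) (l : nat).

Local Notation V := 'rV[K]_l.
Local Notation S := {mpoly K[l]}.

(* The embedding V^* = S_1 -> S; ['X_i] is the i-th coordinate form. *)
Definition form_poly (a : 'Hom(V, K^o)) : S :=
  \sum_(i < l) (a (delta_mx 0 i) : K) *: 'X_i.

(* Stated with a successor because [l.-1] would count K^0 itself as a
   hyperplane of K^0. *)
Definition hyperplane (H : {vspace V}) : Prop := (\dim H).+1 = l.

Definition arrangement (A : {fset {vspace V}}) : Prop :=
  forall H, H \in A -> hyperplane H.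

Definition essential (A : {fset {vspace V}}) : Prop :=
  (\bigcap_(H <- A) H)%VS = 0%VS.

Definition deletion (A : {fset {vspace V}}) (H : {vspace V}) :
    {fset {vspace V}} := (A `\ H)%fset.

(* The members are the hyperplanes of H, seen as subspaces of V. *)
Definition restriction (A : {fset {vspace V}}) (H : {vspace V}) :
    {fset {vspace V}} := [fset (L :&: H)%VS | L in (A `\ H)%fset]%fset.

(* The row vector (f_1, ..., f_l) stands for the derivation
   f_1 d/dx_1 + ... + f_l d/dx_l. *)
Definition der_app (theta : 'rV[S]_l) (p : S) : S :=
  \sum_(i < l) theta 0 i * p^`M(i).

Definition der_homog (d : nat) (theta : 'rV[S]_l) : Prop :=
  forall i, theta 0 i \is d.-homog.

(* The linear forms with kernel H are nonzero scalar multiples of each other,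
   so quantifying over all of them amounts to fixing one alpha_H. *)
Definition logder (A : {fset {vspace V}}) (theta : 'rV[S]_l) : Prop :=
  forall (H : {vspace V}) (a : 'Hom(V, K^o)), H \in A -> lker a = H ->
  exists g : S, der_app theta (form_poly a) = g * form_poly a.

Definition free_with_exp (A : {fset {vspace V}}) (d : 'I_l -> nat) : Prop :=
  exists theta : 'I_l -> 'rV[S]_l,
    [/\ forall i, logder A (theta i),
        forall i, der_homog (d i) (theta i),
        forall eta, logder A eta ->
          exists c : 'I_l -> S, eta = \sum_(i < l) c i *: theta i &
        forall c : 'I_l -> S,
          \sum_(i < l) c i *: theta i = 0 -> forall i, c i = 0].

Definition free_arrangement (A : {fset {vspace V}}) : Prop :=
  exists d : 'I_l -> nat, free_with_exp A d.

(* The sequence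
     0 -> S[-e-1] --(a, f)--> S[-e] (+) (\bigoplus_i S[-(d i)]) -> D(A) -> 0,
   whose second map sends the standard basis to (phi, theta), is a minimal
   graded free resolution of D(A). *)
Record po_resolution (A : {fset {vspace V}}) (d : 'I_l -> nat) (e : nat)
    (theta : 'I_l -> 'rV[S]_l) (phi : 'rV[S]_l)
    (f : 'I_l -> S) (a : 'Hom(V, K^o)) : Prop := PoResolution {
  po_gen_log : forall i, logder A (theta i);
  po_lev_log : logder A phi;
  po_gen_homog : forall i, der_homog (d i) (theta i);
  po_lev_homog : der_homog e phi;
  (* f i lies in S_(e + 1 - d i), which is 0 when e + 1 < d i *)
  po_rel_homog : forall i m, m \in msupp (f i) -> (mdeg m + d i)%N = e.+1;
  po_surj : forall eta, logder A eta ->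
    exists (c : 'I_l -> S) (b : S),
      eta = \sum_(i < l) c i *: theta i + b *: phi;
  po_exact : forall (c : 'I_l -> S) (b : S),
    \sum_(i < l) c i *: theta i + b *: phi = 0 <->
    exists s : S, (forall i, c i = s * f i) /\ b = s * form_poly a;
  po_inj : forall s : S,
    (forall i, s * f i = 0) -> s * form_poly a = 0 -> s = 0;
  (* minimality: the matrix (a, f) has its entries in the irrelevant ideal;
     this is automatic for a, which has degree 1 *)
  po_minimal : forall i, (f i)@_0%MM = 0
}.

Definition plus_one_generated (A : {fset {vspace V}}) (d : 'I_l -> nat)
    (e : nat) : Prop :=
  exists theta phi f a, @po_resolution A d e theta phi f a.

Definition strictly_plus_one_generated (A : {fset {vspace V}})
    (d : 'I_l -> nat) (e : nat) : Prop :=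
  exists theta phi f a, @po_resolution A d e theta phi f a /\ a <> 0.

End Arrangements.

(* Main.v *)
From HB Require Import structures.
Require Import Defs.
From mathcomp Require Import all_boot all_order all_algebra.
From mathcomp Require Import perm finmap mpoly ring zify.

(* Let M be the coefficient matrix of a homogeneous basis theta_i of D(A).
   Saito's criterion gives det M = c Q(A) with c a nonzero constant. Modulo
   alpha = alpha_H the rows of M are derivations of H tangent to A^H, so every
   minor mu_i obtained by deleting row i and a suitable column k is divisible by
   Q(A^H) modulo alpha, say mu_i = v_i Q(A^H). The mu_i give a relation between
   the rows modulo alpha, hence phi = (sum_i v_i theta_i) / alpha is polynomial
   and lies in D(A'), and phi(alpha) Q(A^H) is a nonzero multiple of Q(A') modulo
   alpha. By a divisibility due to Terao, Q(A') divides eta(alpha) Q(A^H) modulo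
   alpha for every eta in D(A'). So eta(alpha) is a multiple of phi(alpha)
   modulo alpha, that is D(A') = D(A) + S phi, with
   alpha phi = sum_i v_i theta_i as the only relation. This is a minimal
   resolution unless some v_i is a nonzero constant, and then phi replaces
   theta_i in a basis of D(A'). *)

Set Implicit Arguments.
Unset Strict Implicit.
Unset Printing Implicit Defensive.

Import GRing.Theory.

(** * Divisibility and coprimality in an integral domain *)

Section Divisibility.
Local Open Scope ring_scope.
Variable R : idomainType.
Implicit Types p q x y : R.

Definition divides p x := exists g, x = g * p.

Definition prime_elt p :=
  [/\ p != 0, ~ divides p 1 &
      forall x y, divides p (x * y) -> divides p x \/ divides p y].

(* Coprimality in the form of Euclid's lemma, which asks for no gcd in [R]. *)
Definition cancels p q := forall x, divides p (q * x) -> divides p x.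

Lemma divides0 p : divides p 0.
Proof. by exists 0; rewrite mul0r. Qed.

Lemma divides_refl p : divides p p.
Proof. by exists 1; rewrite mul1r. Qed.

Lemma divides_mull p x y : divides p x -> divides p (y * x).
Proof. by case=> g ->; exists (y * g); rewrite mulrA. Qed.

Lemma divides_mulr p x y : divides p x -> divides p (x * y).
Proof. by rewrite mulrC; apply: divides_mull. Qed.

Lemma dividesD p x y : divides p x -> divides p y -> divides p (x + y).
Proof. by case=> g -> [h ->]; exists (g + h); rewrite mulrDl. Qed.

Lemma dividesN p x : divides p x -> divides p (- x).
Proof. by case=> g ->; exists (- g); rewrite mulNr. Qed.

Lemma dividesB p x y : divides p x -> divides p y -> divides p (x - y).
Proof. by move=> px py; apply: dividesD px _; apply: dividesN. Qed.

Lemma divides_trans p q x : divides p q -> divides q x -> divides p x.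
Proof. by case=> g -> [h ->]; exists (h * g); rewrite mulrA. Qed.

Lemma divides_sum (I : Type) (s : seq I) (P : pred I) (F : I -> R) p :
  (forall i, P i -> divides p (F i)) -> divides p (\sum_(i <- s | P i) F i).
Proof.
by move=> pF; elim/big_ind: _ => //; [apply: divides0 | apply: dividesD].
Qed.

Lemma cancels_prod (I : eqType) (s : seq I) (F : I -> R) p :
  {in s, forall i, cancels p (F i)} -> cancels p (\prod_(i <- s) F i).
Proof.
elim: s => [|i s IH] Fs x; first by rewrite big_nil mul1r.
rewrite big_cons -mulrA => /(Fs i (mem_head _ _)).
by apply: IH => j sj; apply: Fs; rewrite inE sj orbT.
Qed.

Lemma cancels_exp p q n : cancels p q -> cancels p (q ^+ n).
Proof.
move=> pq; elim: n => [|n IH] x; first by rewrite expr0 mul1r.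
by rewrite exprS -mulrA => /pq /IH.
Qed.

(** Once [x] is [y] times the product of the tail, [F i], being coprime to that product, divides
    [y]. *)
Lemma prod_divides (I : eqType) (s : seq I) (F : I -> R) x :
    uniq s -> {in s &, forall i j, i != j -> cancels (F i) (F j)} ->
    {in s, forall i, divides (F i) x} ->
  divides (\prod_(i <- s) F i) x.
Proof.
elim: s => [|i s IH] /= us Fs Fx; first by exists x; rewrite big_nil mulr1.
have [nsi {}us] := andP us.
have ss j : j \in s -> j \in i :: s by rewrite inE => ->; rewrite orbT.
have [j k sj sk|j sj|y xE] := IH us; [exact/Fs/ss/sk/ss | exact/Fx/ss | ].
have [g yE] : divides (F i) y.
  suff pc : cancels (F i) (\prod_(j <- s) F j).
    by apply: pc; rewrite mulrC -xE; apply: Fx; rewrite mem_head.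
  apply: cancels_prod => j sj; apply: Fs; [exact: mem_head | exact: ss |].
  by apply: contraNneq nsi => ->.
by exists g; rewrite xE yE big_cons mulrA.
Qed.

(** Factors are split off one at a time, so repeated factors are allowed. They do occur: hyperplanes
    with the same trace on [H] have proportional reductions. *)
Lemma cancels_prodl (I : eqType) (s : seq I) (F : I -> R) q :
    {in s, forall i, F i != 0} -> {in s, forall i, cancels (F i) q} ->
  cancels (\prod_(i <- s) F i) q.
Proof.
elim: s => [|i s IH] nzF Fq x.
  by move=> _; exists x; rewrite big_nil mulr1.
have ss j : j \in s -> j \in i :: s by rewrite inE => ->; rewrite orbT.
rewrite big_cons => qx; set P := \prod_(j <- s) F j in qx *.
have nzP : P != 0 by rewrite prodf_seq_neq0; apply/allP => j sj; apply/nzF/ss.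
have [y xE] : divides P x.
  apply: IH => [j sj|j sj|]; [exact/nzF/ss | exact/Fq/ss |].
  by apply: divides_trans qx; apply/divides_mull/divides_refl.
have [g yE] : divides (F i) y.
  apply: (Fq i (mem_head _ _)); have [h hE] := qx; exists h.
  by apply: (mulIf nzP); rewrite -mulrA -xE hE mulrA.
by exists g; rewrite xE yE mulrA.
Qed.

Lemma prime_cancels p q : prime_elt p -> ~ divides p q -> cancels p q.
Proof. by case=> _ _ pp npq x /pp []. Qed.

Lemma prime_divides_prod (I : eqType) (s : seq I) (F : I -> R) p :
    prime_elt p -> {in s, forall i, ~ divides p (F i)} ->
  ~ divides p (\prod_(i <- s) F i).
Proof.
move=> pp nF dF; case: (pp) => _ np1 _; apply: np1.
have /(_ 1) := cancels_prod (fun i si => prime_cancels pp (nF i si)).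
by rewrite mulr1; apply.
Qed.

Lemma prime_divides_exp p q n : prime_elt p -> ~ divides p q ->
  ~ divides p (q ^+ n).
Proof.
move=> pp npq dq; case: (pp) => _ np1 _; apply: np1.
by apply: (cancels_exp (prime_cancels pp npq) (n := n)); rewrite mulr1.
Qed.

(** Each prime [F i] divides [h * t] but not [h], so it divides [t] and cancels from both sides. *)
Lemma cofactor_divides_rest (I : eqType) (s : seq I) (F : I -> R) h t x :
    {in s, forall i, prime_elt (F i) /\ ~ divides (F i) h} ->
  h * t = (\prod_(i <- s) F i) * x -> divides h x.
Proof.
elim: s x t => [|i s IH] x t Fs.
  by rewrite big_nil mul1r => <-; exists t; rewrite mulrC.
have [pi nih] := Fs i (mem_head _ _).
rewrite big_cons -mulrA => e.
have [g tE] : divides (F i) t.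
  by apply: (prime_cancels pi nih); rewrite e mulrC; apply/divides_mull/divides_refl.
apply: (IH x g); first by move=> j sj; apply: Fs; rewrite inE sj orbT.
case: pi => nz _ _; apply: (mulfI nz).
by rewrite -e tE; ring.
Qed.

Lemma coprime_divides_prod_exp (I : eqType) (s : seq I) (F : I -> R) h n :
    {in s, forall i, prime_elt (F i) /\ ~ divides (F i) h} ->
  divides h ((\prod_(i <- s) F i) ^+ n) -> divides h 1.
Proof.
move=> Fs; elim: n => [|n IH] //; rewrite exprS => -[t e]; apply: IH.
by apply: (cofactor_divides_rest (t := t) Fs); rewrite mulrC -e.
Qed.

(* Cramer: [\adj N *m N = \det N], so the determinant kills [u] modulo [p]. *)
Lemma det_divides n (N : 'M[R]_n) (u : 'cV[R]_n) p :
    (forall i, divides p ((N *m u) i 0)) ->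
  forall j, divides p (\det N * u j 0).
Proof.
move=> pNu j; rewrite -mulrC mulrC.
have -> : \det N * u j 0 = (\adj N *m (N *m u)) j 0.
  by rewrite mulmxA mul_adj_mx mul_scalar_mx mxE.
by rewrite mxE; apply: divides_sum => i _; apply: divides_mull.
Qed.

End Divisibility.

(** * Linear forms, homogeneous factors and reduction modulo a linear form *)

Section LinearForms.
Local Open Scope ring_scope.
Variables (K : fieldType) (l : nat).
Local Notation S := {mpoly K[l]}.
Implicit Types (u v w : 'rV[K]_l) (p q : S).

Definition linear_form u : S := \sum_(i < l) u 0 i *: 'X_i.

Lemma linear_form_is_linear : linear linear_form.
Proof.
move=> c u v; rewrite /linear_form scaler_sumr -big_split /=.
by apply: eq_bigr => i _; rewrite !mxE scalerDl scalerA.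
Qed.

HB.instance Definition _ :=
  GRing.isLinear.Build K 'rV[K]_l S _ linear_form linear_form_is_linear.

Lemma mcoeff_linear_form u i : (linear_form u)@_U_(i) = u 0 i.
Proof.
rewrite raddf_sum (bigD1 i) //= linearZ /= mcoeffXU eqxx mulr1 big1 ?addr0 //.
by move=> j ji; rewrite linearZ /= mcoeffXU (negPf ji) mulr0.
Qed.

Lemma linear_form_inj : injective linear_form.
Proof.
by move=> u v uv; apply/rowP => i; rewrite -!mcoeff_linear_form uv.
Qed.

Lemma linear_form_eq0 u : (linear_form u == 0) = (u == 0).
Proof. by rewrite -(raddf0 linear_form) (inj_eq linear_form_inj). Qed.

Lemma dhomog_linear_form u : linear_form u \is 1.-homog.
Proof. by apply: rpred_sum => i _; apply: rpredZ; rewrite dhomogX /= mdeg1. Qed.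

Lemma dhomog_prod_seq (I : Type) (s : seq I) (F : I -> S) (d : I -> nat) :
    (forall i, F i \is (d i).-homog) ->
  \prod_(i <- s) F i \is (\sum_(i <- s) d i)%N.-homog.
Proof.
move=> hF; elim: s => [|i s IH]; first by rewrite !big_nil dhomog1.
by rewrite !big_cons dhomogM.
Qed.

(** The component of [p * q] in degree [mdeg m + e] is [q] times the component of [p] in degree
    [mdeg m], hence nonzero in a domain. The additive conclusion avoids the truncated [d - e]. *)
Lemma homog_factor p q d e :
    q != 0 -> q \is e.-homog -> p * q \is d.-homog ->
  forall m, m \in msupp p -> (mdeg m + e)%N = d.
Proof.
move=> nzq hq hpq m mp; apply/eqP/negPn/negP => ne.
have pE := pihomog_partitionE (mf := mdeg) (leqnn (msize p)).
have hk k : pihomog mdeg k p * q \is (k + e)%N.-homog.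
  by rewrite dhomogM ?pihomogP.
have: pihomog mdeg (mdeg m + e) (p * q) = 0.
  by apply: pihomog_ne0 hpq; rewrite eq_sym.
rewrite {1}pE mulr_suml raddf_sum /= (bigD1 (Ordinal (msize_mdeg_lt mp))) //=.
rewrite big1 ?addr0 => [|i ni]; last first.
  apply: pihomog_ne0 (hk i); rewrite eqn_add2r.
  by apply: contraNneq ni => e'; apply/eqP/val_inj.
rewrite pihomog_dE // => /eqP; rewrite mulf_eq0 (negPf nzq) orbF => /eqP p0.
move: mp; rewrite mcoeff_msupp => /eqP; apply.
rewrite pE raddf_sum /= big1 // => i _.
have [<-|ni] := eqVneq (mdeg m) i; first by rewrite p0 mcoeff0.
exact: dhomog_nemf_coeff (pihomogP _ _ _) ni.
Qed.

Lemma dhomog_factor p q d e :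
  q != 0 -> q \is e.-homog -> p * q \is (d + e).-homog -> p \is d.-homog.
Proof.
move=> nzq hq hpq; apply/dhomogP => m mp.
by apply/eqP; rewrite -(eqn_add2r e) (homog_factor nzq hq hpq).
Qed.

Lemma dhomog_det n (N : 'M[S]_n) (d : 'I_n -> nat) :
    (forall i j, N i j \is (d i).-homog) ->
  \det N \is (\sum_i d i)%N.-homog.
Proof.
move=> hN; apply: rpred_sum => s _; rewrite -signr_odd mulr_sign.
have h := dhomog_prod_seq (index_enum 'I_n) (fun i => hN i (s i)).
by case: odd; rewrite ?rpredN; apply: h.
Qed.

(* Substitution of [x_k - u / u_k] for [x_k]: a retraction of [S] onto a
   subring isomorphic to [S / (u)], so that congruences modulo the linear
   form [u] become equations in [S]. *)
Definition reduce u k p : S :=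
  p \mPo [tuple 'X_i - ((i == k)%:R / u 0 k) *: linear_form u | i < l].

HB.instance Definition _ u k :=
  GRing.RMorphism.copy (reduce u k) (comp_mpoly
    [tuple 'X_i - ((i == k)%:R / u 0 k) *: linear_form u | i < l]).
HB.instance Definition _ u k :=
  GRing.Linear.copy (reduce u k) (comp_mpoly
    [tuple 'X_i - ((i == k)%:R / u 0 k) *: linear_form u | i < l]).

Lemma reduceX u k i :
  reduce u k 'X_i = 'X_i - ((i == k)%:R / u 0 k) *: linear_form u.
Proof. by rewrite /reduce comp_mpolyXU -tnth_nth tnth_mktuple. Qed.

Lemma reduce_linear_form u k w :
  reduce u k (linear_form w) = linear_form (w - (w 0 k / u 0 k) *: u).
Proof.
rewrite {1}/linear_form linear_sum /= raddfB /= linearZ /=.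
under eq_bigr do rewrite linearZ /= reduceX scalerBr scalerA.
rewrite big_split /= sumrN; congr (_ - _).
rewrite (bigD1 k) //= big1 ?addr0 => [|i ik].
  by rewrite eqxx mulrA mulr1.
by rewrite (negPf ik) mul0r mulr0 scale0r.
Qed.

Lemma reduce_self u k : u 0 k != 0 -> reduce u k (linear_form u) = 0.
Proof.
by move=> uk; rewrite reduce_linear_form divff // scale1r subrr raddf0.
Qed.

Lemma divides_sub_reduce u k p : divides (linear_form u) (p - reduce u k p).
Proof.
elim/mpolyind: p => [|c m p _ _ IH]; first by rewrite rmorph0 subr0; apply: divides0.
rewrite raddfD /= opprD addrACA; apply: dividesD => //.
rewrite linearZ /= -scalerBr -mul_mpolyC; apply: divides_mull.
(* Congruence modulo [u] passes to products, so it need only be checked on the variables. *)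
have prodB (s : seq 'I_l) (F G : 'I_l -> S) :
    (forall i, divides (linear_form u) (F i - G i)) ->
  divides (linear_form u) (\prod_(i <- s) F i - \prod_(i <- s) G i).
  move=> FG; elim: s => [|i s IHs]; first by rewrite !big_nil subrr; apply: divides0.
  rewrite !big_cons; set P := bigop _ _ _ in IHs *; set Q := bigop _ _ _ in IHs *.
  have -> : F i * P - G i * Q = P * (F i - G i) + G i * (P - Q) by ring.
  by apply: dividesD; apply: divides_mull.
rewrite mpolyXE_id rmorph_prod /=; apply: prodB => i; rewrite rmorphXn /=.
rewrite subrXX reduceX opprB addrC subrK mulrC -mul_mpolyC.
by apply/divides_mull/divides_mull/divides_refl.
Qed.

Lemma reduce_eq0 u k p : u 0 k != 0 ->
  reduce u k p = 0 <-> divides (linear_form u) p.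
Proof.
move=> uk; split=> [p0|[g ->]]; last by rewrite rmorphM /= reduce_self ?mulr0.
by have := divides_sub_reduce u k p; rewrite p0 subr0.
Qed.

Lemma reduce_idem u k p : u 0 k != 0 -> reduce u k (reduce u k p) = reduce u k p.
Proof.
move=> uk; apply/esym/eqP; rewrite -subr_eq0 -raddfB /=.
exact/eqP/(reduce_eq0 _ uk)/divides_sub_reduce.
Qed.

Lemma dhomog_reduce u k p d : p \is d.-homog -> reduce u k p \is d.-homog.
Proof.
move=> /dhomogP hp; rewrite /reduce comp_mpolyEX big_seq; apply: rpred_sum => m mp.
have <- : mdeg m = d := hp m mp.
rewrite mdegE comp_mpolyX; apply: rpredZ.
apply: dhomog_prod_seq => i.
rewrite -[X in X.-homog]mul1n; apply: dhomogMn; rewrite tnth_mktuple.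
by rewrite rpredB ?rpredZ ?dhomog_linear_form // dhomogX /= mdeg1.
Qed.

Lemma row_neq0_ex u : u != 0 -> exists k, u 0 k != 0.
Proof. by move=> /rV0Pn. Qed.

(** The kernel of [reduce] is the ideal of [u] and its values lie in the domain [S], so the quotient
    by [u] is a domain. *)
Lemma linear_form_prime u : u != 0 -> prime_elt (linear_form u).
Proof.
move=> nzu; have [k uk] := row_neq0_ex nzu; split.
- by rewrite linear_form_eq0.
- by move/(reduce_eq0 _ uk)/eqP; rewrite rmorph1 oner_eq0.
move=> x y /(reduce_eq0 _ uk)/eqP; rewrite rmorphM mulf_eq0 /=.
by case/orP=> /eqP/(reduce_eq0 _ uk); [left | right].
Qed.

Lemma linear_form_divides u w : u != 0 ->
  divides (linear_form u) (linear_form w) -> exists c, w = c *: u.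
Proof.
move=> nzu; have [k uk] := row_neq0_ex nzu.
move/(reduce_eq0 _ uk)/eqP; rewrite reduce_linear_form linear_form_eq0 subr_eq0.
by move/eqP->; exists (w 0 k / u 0 k).
Qed.

Lemma divides1_mpolyC p : divides p 1 -> exists2 c : K, c != 0 & p = c%:MP.
Proof.
case=> g /esym/mpoly_intro_unit/andP[/eqP pE]; rewrite unitfE => nz.
by exists p@_0%MM.
Qed.

End LinearForms.

(** * Hyperplanes and their normal vectors *)

Section Hyperplanes.
Local Open Scope ring_scope.
Variables (K : fieldType) (l : nat).
Local Notation V := 'rV[K]_l.
Implicit Types (u v w x : V) (a : 'Hom(V, K^o)) (L : {vspace V}).

Definition form_row a : V := \row_i (a (delta_mx 0 i) : K).

Lemma form_polyE a : form_poly a = linear_form (form_row a).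
Proof. by apply: eq_bigr => i _; rewrite mxE. Qed.

Lemma form_row_apply a x : a x = (x *m (form_row a)^T) 0 0.
Proof.
rewrite {1}[x]row_sum_delta linear_sum mxE /=; apply: eq_bigr => i _.
by rewrite linearZ /= !mxE.
Qed.

Lemma mem_lker_form_row a x : (x \in lker a) = (x *m (form_row a)^T == 0).
Proof.
rewrite memv_ker form_row_apply; apply/eqP/eqP => [e|->]; last by rewrite mxE.
by apply/matrixP => i j; rewrite !ord1 e mxE.
Qed.

Lemma form_row_eq0 a : form_row a = 0 -> lker a = fullv.
Proof.
move=> a0; apply/vspaceP => x.
by rewrite mem_lker_form_row a0 trmx0 mulmx0 eqxx memvf.
Qed.

Lemma hyperplane_form_row_neq0 a : hyperplane (lker a) -> form_row a != 0.
Proof.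
move=> hA; apply/eqP => /form_row_eq0 e; move: hA; rewrite /hyperplane e.
by rewrite dimvf /dim /= mul1n => /eqP; rewrite eqn_leq ltnn.
Qed.

Lemma form_of_row u : exists a, form_row a = u.
Proof.
have lin : linear (fun x : V => (x *m u^T) 0 0 : K^o).
  by move=> c x y; rewrite mulmxDl -scalemxAl !mxE.
pose f : {linear V -> K^o} := HB.pack (fun x : V => (x *m u^T) 0 0 : K^o)
  (GRing.isLinear.Build _ _ _ _ _ lin).
exists (linfun f); apply/rowP => i; rewrite mxE lfunE /= -rowE !mxE //.
Qed.

(** Since [\dim L < l], some nonzero [u] is orthogonal to a basis of [L]. Its form vanishes on [L],
    and rank-nullity gives equality of dimensions. *)
Lemma hyperplane_form L : hyperplane L -> exists a, lker a = L.
Proof.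
move=> hL; pose M := \matrix_(i < \dim L) (vbasis L)`_i.
have nz : kermx M^T != 0.
  rewrite -mxrank_eq0 mxrank_ker subn_eq0 -ltnNge.
  by rewrite (leq_ltn_trans (rank_leq_col _)) // -[X in (_ < X)%N]hL.
have [u uk nzu] := rowV0Pn nz.
have [a aE] := form_of_row u; exists a; apply/esym/eqP.
rewrite eqEdim; apply/andP; split.
  rewrite -(span_basis (vbasisP L)); apply/span_subvP => x.
  case/(nthP 0) => i; rewrite size_tuple => iL <-.
  have -> : (vbasis L)`_i = row (Ordinal iL) M by rewrite rowK.
  rewrite mem_lker_form_row aE.
  rewrite -row_mul -[M]trmxK -trmx_mul.
  have := sub_kermxP uk => ->; by rewrite trmx0 row0.
have /= := limg_ker_dim a fullv; rewrite capfv dimvf /dim /= mul1n => e.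
rewrite -ltnS hL -[X in (_ < X)%N]e -[X in (X < _)%N]addn0 ltn_add2l lt0n dimv_eq0.
apply: contraNneq nzu => a0; rewrite -aE; apply/eqP/rowP => i; rewrite !mxE.
by have := memv_img a (memvf (delta_mx 0 i)); rewrite a0 memv0 => /eqP.
Qed.

(** The columns of [cokermx C] lie in the common kernel of [u] and [v], so [w] kills them, which
    puts [w] in the row space of [C]. *)
Lemma row_in_span u v w :
    (forall x, x *m u^T = 0 -> x *m v^T = 0 -> x *m w^T = 0) ->
  exists s t, w = s *: u + t *: v.
Proof.
move=> h; pose C := col_mx u v.
have /submxP[D ->] : (w <= C)%MS.
  rewrite submxE; apply/eqP; rewrite -[_ *m _]trmxK trmx_mul -trmx0; congr (_^T).
  have /eqP := mulmx_coker C; rewrite mul_col_mx col_mx_eq0 => /andP[/eqP Cu /eqP Cv].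
  apply/row_matrixP => i; rewrite row_mul row0.
  by apply: h; rewrite -row_mul -trmx_mul ?Cu ?Cv trmx0 row0.
exists (lsubmx D 0 0), (rsubmx D 0 0).
rewrite -{1}[D]hsubmxK mul_row_col.
by rewrite {1}[lsubmx D]mx11_scalar {1}[rsubmx D]mx11_scalar !mul_scalar_mx.
Qed.

Lemma lker_colinear a b :
  (lker a <= lker b)%VS -> exists c, form_row b = c *: form_row a.
Proof.
move=> /subvP ab; have [|s [t ->]] := @row_in_span (form_row a) (form_row a) (form_row b).
  move=> x /eqP ax _; apply/eqP; rewrite -mem_lker_form_row; apply: ab.
  by rewrite mem_lker_form_row.
by exists (s + t); rewrite scalerDl.
Qed.

Lemma der_app_linear_form (theta : 'rV[{mpoly K[l]}]_l) u :
  der_app theta (linear_form u) = \sum_i u 0 i *: theta 0 i.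
Proof.
apply: eq_bigr => i _; rewrite linear_sum /= (bigD1 i) //= big1 ?addr0.
  rewrite linearZ /= mderivX mnm1E eqxx scale1r.
  have -> : (U_(i) - U_(i) = 0)%MM by apply/mnmP => j; rewrite mnmBE mnm0E subnn.
  rewrite mpolyX0.
  by rewrite -scalerAr mulr1.
by move=> j ji; rewrite linearZ /= mderivX mnm1E (negPf ji) scale0r scaler0.
Qed.

End Hyperplanes.

(** * Logarithmic derivations and Saito's criterion *)

Section LogarithmicDerivations.
Local Open Scope ring_scope.
Variables (K : fieldType) (l : nat).
Local Notation V := 'rV[K]_l.
Local Notation S := {mpoly K[l]}.
Implicit Types (u v : V) (p q : S) (eta : 'rV[S]_l) (L : {vspace V}).

Lemma der_app_linear (c : K) eta p q :
  der_app eta (c *: p + q) = c *: der_app eta p + der_app eta q.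
Proof.
rewrite /der_app scaler_sumr -big_split /=; apply: eq_bigr => i _.
by rewrite linearP /= mulrDr -scalerAr.
Qed.

Lemma der_appZ (c : K) eta p : der_app eta (c *: p) = c *: der_app eta p.
Proof.
rewrite -[c *: p]addr0 der_app_linear [X in _ + X]big1 ?addr0 // => i _.
by rewrite linear0 mulr0.
Qed.

Lemma der_appZl q eta p : der_app (q *: eta) p = q * der_app eta p.
Proof. by rewrite mulr_sumr; apply: eq_bigr => i _; rewrite mxE mulrA. Qed.

Lemma der_appD eta1 eta2 p :
  der_app (eta1 + eta2) p = der_app eta1 p + der_app eta2 p.
Proof. by rewrite -big_split; apply: eq_bigr => i _; rewrite mxE mulrDl. Qed.

Lemma der_app_sum (I : finType) (F : I -> 'rV[S]_l) p :
  der_app (\sum_i F i) p = \sum_i der_app (F i) p.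
Proof.
rewrite exchange_big; apply: eq_bigr => i _ /=.
by rewrite summxE mulr_suml.
Qed.

Lemma dividesZ p q (c : K) : c != 0 -> divides p (c *: q) -> divides p q.
Proof.
move=> nzc [g e]; exists (c^-1 *: g).
by rewrite -scalerAl -e scalerA mulVf ?scale1r.
Qed.

Lemma divides_scale p q (c : K) : divides p q -> divides p (c *: q).
Proof. by case=> g ->; exists (c *: g); rewrite scalerAl. Qed.

(** Cramer's rule for the constant column [u], a nonzero coordinate of which is a unit of [S]. *)
Lemma det_divides_form (N : 'M[S]_l) u p : u != 0 ->
    (forall i, divides p (\sum_j u 0 j *: N i j)) ->
  divides p (\det N).
Proof.
move=> /row_neq0_ex[k uk] h.
pose U : 'cV[S]_l := \col_j (u 0 j)%:MP.
have /(_ k) : forall j, divides p (\det N * U j 0).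
  apply: det_divides => i; rewrite mxE.
  under eq_bigr do rewrite mxE mulrC mul_mpolyC; exact: h.
by rewrite mxE mulrC mul_mpolyC => /(dividesZ uk).
Qed.

Variables (A : {fset {vspace V}}) (form : {vspace V} -> 'Hom(V, K^o)).
Hypothesis hypA : arrangement A.
Hypothesis formK : {in A, forall L, lker (form L) = L}.

Definition normal_of L := form_row (form L).
Definition alpha_of L : S := linear_form (normal_of L).

Lemma normal_neq0 L : L \in A -> normal_of L != 0.
Proof.
by move=> LA; apply: hyperplane_form_row_neq0; rewrite formK //; apply: hypA.
Qed.

Lemma mem_normal L (x : V) : L \in A -> (x \in L) = (x *m (normal_of L)^T == 0).
Proof. by move=> LA; rewrite -mem_lker_form_row formK. Qed.

Lemma alpha_prime L : L \in A -> prime_elt (alpha_of L).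
Proof. by move=> LA; apply/linear_form_prime/normal_neq0. Qed.

Lemma normal_colinear L L' c : L \in A -> L' \in A ->
  normal_of L' = c *: normal_of L -> L' = L.
Proof.
move=> LA LA' e; apply/vspaceP => x; rewrite !mem_normal // e.
rewrite linearZ /= -scalemxAr scaler_eq0.
suff /negPf-> : c != 0 by [].
by apply: contraNneq (normal_neq0 LA') => c0; rewrite e c0 scale0r.
Qed.

Lemma alpha_ndvd L L' : L \in A -> L' \in A -> L != L' ->
  ~ divides (alpha_of L) (alpha_of L').
Proof.
move=> LA LA' ne /(linear_form_divides (normal_neq0 LA))[c e].
by move: ne; rewrite (normal_colinear LA LA' e) eqxx.
Qed.

Lemma alpha_cancels L L' : L \in A -> L' \in A -> L != L' ->
  cancels (alpha_of L) (alpha_of L').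
Proof.
by move=> LA LA' ne; apply: prime_cancels; [apply: alpha_prime | apply: alpha_ndvd].
Qed.

(** Forms with the same kernel are proportional, so one form per hyperplane suffices. A single
    choice [form] serves both [A] and its deletion. *)
Lemma logderP (B : {fset {vspace V}}) eta : {subset B <= A} ->
  logder B eta <-> {in B, forall L, divides (alpha_of L) (der_app eta (alpha_of L))}.
Proof.
move=> BA; split=> [h L LB|h L a LB aL].
  have [g] := h L (form L) LB (formK (BA _ LB)).
  by rewrite form_polyE => e; exists g.
have [c e] : exists c, form_row a = c *: normal_of L.
  by apply: lker_colinear; rewrite formK ?BA // aL.
rewrite form_polyE e linearZ /= der_appZ; case: (h L LB) => g ->.
by exists g; rewrite scalerAr.
Qed.

Definition defining_poly (B : {fset {vspace V}}) : S := \prod_(L <- B) alpha_of L.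

Lemma defining_poly_neq0 (B : {fset {vspace V}}) : {subset B <= A} ->
  defining_poly B != 0.
Proof.
move=> BA; rewrite prodf_seq_neq0; apply/allP => L LB /=.
by rewrite linear_form_eq0 normal_neq0 ?BA.
Qed.

Lemma dhomog_defining_poly (B : {fset {vspace V}}) :
  defining_poly B \is (#|` B|).-homog.
Proof.
rewrite -[#|` _|]sum1_size; apply: dhomog_prod_seq => L.
exact: dhomog_linear_form.
Qed.

Lemma divides_defining_poly (B : {fset {vspace V}}) L : L \in B ->
  divides (alpha_of L) (defining_poly B).
Proof.
by move=> LB; rewrite /defining_poly (big_fsetD1 L) //=; apply/divides_mulr/divides_refl.
Qed.

Lemma defining_polyD1 (B : {fset {vspace V}}) L : L \in B ->
  defining_poly B = alpha_of L * defining_poly (B `\ L)%fset.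
Proof. by move=> LB; rewrite /defining_poly (big_fsetD1 L). Qed.

Variable theta : 'I_l -> 'rV[S]_l.
Hypothesis theta_log : forall i, logder A (theta i).
Hypothesis theta_gen : forall eta, logder A eta ->
  exists c : 'I_l -> S, eta = \sum_(i < l) c i *: theta i.

Definition coef_mx : 'M[S]_l := \matrix_i theta i.

Lemma coef_mxE i j : coef_mx i j = theta i 0 j.
Proof. by rewrite mxE. Qed.

Lemma theta_alpha i L : L \in A ->
  divides (alpha_of L) (der_app (theta i) (alpha_of L)).
Proof. by move=> LA; have /logderP := theta_log i; apply. Qed.

(** The values of the [theta i] on [alpha_of L] are a constant combination of the columns of
    [coef_mx]. All are divisible by [alpha_of L], hence so is the determinant; distinct forms are
    coprime. *)
Lemma defining_poly_divides_det : divides (defining_poly A) (\det coef_mx).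
Proof.
apply: prod_divides => [|L L' LA LA'|L LA]; first exact: fset_uniq.
  exact: alpha_cancels.
apply: (det_divides_form (normal_neq0 LA)) => i.
by under eq_bigr do rewrite coef_mxE; rewrite -der_app_linear_form; apply: theta_alpha.
Qed.

(* With [Q_L = Q / alpha_L], the derivations [Q_L d_v] for [v] in [L] and
   [Q d_k] lie in [D(A)], and their coefficient determinant is [Q Q_L^(l-1)]. *)
Lemma det_divides_defining_poly L : L \in A ->
  exists n, divides (\det coef_mx)
    (defining_poly A * defining_poly (A `\ L)%fset ^+ n).
Proof.
move=> LA; have [k ck] := row_neq0_ex (normal_neq0 LA).
pose c := normal_of L.
pose q j := if j == k then defining_poly A else defining_poly (A `\ L)%fset.
(* For [j != k] row [j] is [d_j - (c_j / c_k) d_k], which kills the form of [L]; row [k] is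
   [d_k]. *)
pose U : 'M[K]_l :=
  \matrix_(j, i) ((i == j)%:R - (i == k)%:R * ((j != k)%:R * (c 0 j / c 0 k))).
pose E : 'M[S]_l := \matrix_(j, i) (q j * (U j i)%:MP).
have UE j i : U j i = (i == j)%:R - (i == k)%:R * ((j != k)%:R * (c 0 j / c 0 k)).
  by rewrite mxE.
have EE j i : E j i = q j * (U j i)%:MP by rewrite mxE.
have Uc j : \sum_i c 0 i * U j i = (j == k)%:R * c 0 k.
  under eq_bigr do rewrite UE mulrBr.
  rewrite sumrB (bigD1 j) //= big1 ?addr0 => [|i /negPf->]; last by rewrite mulr0.
  rewrite (bigD1 k) //= big1 ?addr0 => [|i /negPf->]; last by rewrite mul0r mulr0.
  rewrite !eqxx mulr1 mul1r; have [->|jk] := eqVneq j k.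
    by rewrite mul0r mulr0 subr0 mul1r.
  by rewrite !mul1r mul0r mulrCA divff // mulr1 subrr.
have Elog j : logder A (row j E).
  apply/logderP => // L' LA'; rewrite der_app_linear_form.
  under eq_bigr do rewrite [row j E 0 _]mxE EE -mul_mpolyC mulrCA.
  (* The factor [q j] already contains the form of [L'], except when [j != k] and [L' = L]; there
     row [j] of [U] kills the form. *)
  rewrite -mulr_sumr; have [qL'|] := boolP ((j == k) || (L' != L)).
    apply: divides_mulr; rewrite /q; move: qL'; case: eqP => _ /= qL'.
      exact: divides_defining_poly.
    by apply: divides_defining_poly; rewrite !inE qL'.
  rewrite negb_or negbK => /andP[jk /eqP->].
  under eq_bigr => i _ do rewrite -mpolyCM.
  have := Uc j; rewrite (negPf jk) mul0r => e.
  by rewrite -rmorph_sum e rmorph0 mulr0; apply: divides0.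
have [C EC] := fin_all_exists (fun j => theta_gen (Elog j)).
have detE : \det E = \prod_j q j.
  have -> : E = diag_mx (\row_j q j) *m map_mx (@mpolyC l K) U.
    by apply/matrixP => i j; rewrite mul_diag_mx !mxE.
  rewrite det_mulmx det_diag det_map_mx.
  have -> : \det U = 1.
    (* Row [k] of [U] is a unit vector, and deleting row and column [k] leaves the identity. *)
    rewrite (expand_det_row _ k) (bigD1 k) //= big1 ?addr0 => [|i /negPf ik].
      rewrite UE !eqxx mul0r mulr0 subr0 mul1r /cofactor -signr_odd addnn odd_double mul1r.
      rewrite -(det1 K l.-1); congr (\det _); apply/matrixP => i j.
      rewrite !mxE (inj_eq lift_inj) eq_sym [lift k j == k]eq_sym (negPf (neq_lift k j)).
      by rewrite mul0r subr0.
    by rewrite UE ik eqxx mul0r subr0 mul0r.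
  by rewrite rmorph1 mulr1; apply: eq_bigr => j _; rewrite mxE.
exists #|[pred j : 'I_l | j != k]|.
have <- : \prod_j q j = defining_poly A *
    defining_poly (A `\ L)%fset ^+ #|[pred j : 'I_l | j != k]|.
  rewrite (bigD1 k) //= {1}/q eqxx; congr (_ * _).
  by rewrite -prodr_const; apply: eq_bigr => j /negPf jk; rewrite /q jk.
exists (\det (\matrix_(j, i) C j i)); rewrite -detE -det_mulmx; congr (\det _).
apply/matrixP => j i; have /rowP/(_ i) := EC j; rewrite mxE => ->.
by rewrite summxE !mxE; apply: eq_bigr => m _; rewrite !mxE.
Qed.

(** Write the determinant as [h * Q]. For each [L], [h] divides a power of [Q / alpha_L], so
    [alpha_L] does not divide [h]. Being coprime to [Q] and dividing a power of it, [h] is a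
    constant. *)
Lemma saito : A != fset0 ->
  exists2 c : K, c != 0 & \det coef_mx = c *: defining_poly A.
Proof.
move=> /fset0Pn[L0 L0A]; have [h hE] := defining_poly_divides_det.
have nzQ : defining_poly A != 0 by apply: defining_poly_neq0.
have hQ L : L \in A -> exists n, divides h (defining_poly (A `\ L)%fset ^+ n).
  move=> LA; have [n [t e]] := det_divides_defining_poly LA.
  exists n, t; apply: (mulfI nzQ); rewrite e hE; ring.
have nh : {in A, forall L, prime_elt (alpha_of L) /\ ~ divides (alpha_of L) h}.
  move=> L LA; have pL := alpha_prime LA; split=> // Lh.
  have [n hn] := hQ L LA; have := divides_trans Lh hn.
  apply: prime_divides_exp => //; apply: prime_divides_prod => // L'.
  by rewrite !inE eq_sym => /andP[ne LA']; apply: alpha_ndvd.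
have [n hn] := hQ L0 L0A.
have /divides1_mpolyC[c nzc hc] : divides h 1.
  apply: (coprime_divides_prod_exp (n := n) nh); apply: divides_trans hn _.
  rewrite -/(defining_poly A) (defining_polyD1 L0A) exprMn.
  exact/divides_mull/divides_refl.
by exists c; rewrite // hE hc mul_mpolyC.
Qed.

End LogarithmicDerivations.

(** * Restriction to [H] and Terao's divisibility *)

Section Deletion.
Local Open Scope ring_scope.
Variables (K : fieldType) (l : nat).
Local Notation V := 'rV[K]_l.
Local Notation S := {mpoly K[l]}.
Implicit Types (u v : V) (p q : S) (eta : 'rV[S]_l) (L : {vspace V}).

Variables (A : {fset {vspace V}}) (form : {vspace V} -> 'Hom(V, K^o)).
Hypothesis hypA : arrangement A.
Hypothesis formK : {in A, forall L, lker (form L) = L}.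
Variable H : {vspace V}.
Hypothesis HA : H \in A.
Variable k : 'I_l.
Hypothesis Hk : normal_of form H 0 k != 0.

Local Notation A' := (deletion A H).
Local Notation A'' := (restriction A H).
Local Notation normal := (normal_of form).
Local Notation alpha := (alpha_of form).
Local Notation rho := (reduce (normal H) k).

Lemma deletion_subset : {subset A' <= A}.
Proof. by move=> L; rewrite !inE => /andP[]. Qed.

Lemma deletion_neq L : L \in A' -> L != H.
Proof. by rewrite !inE => /andP[]. Qed.

Lemma reduce_alpha_self : rho (alpha H) = 0.
Proof. exact: reduce_self. Qed.

(** The restriction of the form of [L] to [H], written in the coordinates other than the [k]-th. *)
Definition reduced_normal L : V := normal L - (normal L 0 k / normal H 0 k) *: normal H.
Definition reduced_alpha L : S := linear_form (reduced_normal L).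

Lemma reduce_alpha L : rho (alpha L) = reduced_alpha L.
Proof. exact: reduce_linear_form. Qed.

Lemma reduce_reduced_alpha L : rho (reduced_alpha L) = reduced_alpha L.
Proof. by rewrite -reduce_alpha reduce_idem. Qed.

Lemma reduced_normal_k L : reduced_normal L 0 k = 0.
Proof. by rewrite mxE [X in _ + X]mxE [X in _ - X]mxE divfK ?subrr. Qed.

Lemma reduced_normal_neq0 L : L \in A' -> reduced_normal L != 0.
Proof.
move=> LA'; rewrite subr_eq0; apply/eqP => e.
have := normal_colinear hypA formK HA (deletion_subset LA') e.
by move=> LH; have := deletion_neq LA'; rewrite LH eqxx.
Qed.

Lemma reduced_alpha_prime L : L \in A' -> prime_elt (reduced_alpha L).
Proof. by move=> LA'; apply/linear_form_prime/reduced_normal_neq0. Qed.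

Lemma mem_cap_reduced L (x : V) : L \in A' ->
  (x \in (L :&: H)%VS) = (x \in H) && (x *m (reduced_normal L)^T == 0).
Proof.
move=> LA'; rewrite memv_cap andbC; have [xH|//] := boolP (x \in H).
rewrite (mem_normal formK _ (deletion_subset LA')) /=.
rewrite linearB linearZ /= mulmxBr -scalemxAr.
by have := xH; rewrite (mem_normal formK _ HA) => /eqP ->; rewrite scaler0 subr0.
Qed.

Lemma reduced_alpha_cancels L L' : L \in A' -> L' \in A' ->
  (L :&: H != L' :&: H)%VS -> cancels (reduced_alpha L) (reduced_alpha L').
Proof.
move=> LA' LA2 ne; apply: prime_cancels; first exact: reduced_alpha_prime.
move=> /(linear_form_divides (reduced_normal_neq0 LA'))[c e].
case/eqP: ne; apply/vspaceP => x; rewrite !mem_cap_reduced // e.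
rewrite linearZ /= -scalemxAr scaler_eq0.
suff /negPf-> : c != 0 by [].
by apply: contraNneq (reduced_normal_neq0 LA2) => c0; rewrite e c0 scale0r.
Qed.

(** Picks one member of [A'] with trace [X] on [H]; the default [H] is returned only if there is
    none. *)
Definition flat_rep (X : {vspace V}) : {vspace V} :=
  head H [seq L <- A' | (L :&: H)%VS == X].

Lemma flat_repP X : X \in A'' ->
  flat_rep X \in A' /\ (flat_rep X :&: H)%VS = X.
Proof.
case/imfsetP => L /= LA' XE.
have : L \in [seq L <- A' | (L :&: H)%VS == X] by rewrite mem_filter XE eqxx.
rewrite /flat_rep; case E : [seq _ <- _ | _] => [//|L1 s] _ /=.
have : L1 \in [seq L <- A' | (L :&: H)%VS == X] by rewrite E mem_head.
by rewrite mem_filter => /andP[/eqP].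
Qed.

(* The image of [reduce] stands for [S / (alpha_H)]; there this product is the
   defining polynomial of [A^H]. *)
Definition restriction_poly : S := \prod_(X <- A'') reduced_alpha (flat_rep X).

Lemma restriction_poly_neq0 : restriction_poly != 0.
Proof.
rewrite prodf_seq_neq0; apply/allP => X /flat_repP[XA' _] /=.
by have [] := reduced_alpha_prime XA'.
Qed.

Lemma dhomog_restriction_poly : restriction_poly \is (#|` A''|).-homog.
Proof.
rewrite -[#|` _|]sum1_size; apply: dhomog_prod_seq => L.
exact: dhomog_linear_form.
Qed.

Lemma reduce_restriction_poly : rho restriction_poly = restriction_poly.
Proof. by rewrite rmorph_prod; apply: eq_bigr => X _; rewrite /= reduce_reduced_alpha. Qed.

Lemma reduce_defining_poly :
  rho (defining_poly form A') = \prod_(L <- A') reduced_alpha L.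
Proof. by rewrite rmorph_prod; apply: eq_bigr => L _; rewrite /= reduce_alpha. Qed.

(** The form of [L] vanishes on [L0 :&: H], so it lies in the pencil; [t = 0] would force
    [L = H]. *)
Lemma normal_in_pencil L L0 : L \in A' -> L0 \in A' ->
    (L :&: H = L0 :&: H)%VS ->
  exists s t, t != 0 /\ normal L = s *: normal H + t *: normal L0.
Proof.
move=> LA' L0A' e; have LA := deletion_subset LA'.
have [|s [t nE]] := @row_in_span _ _ (normal H) (normal L0) (normal L).
  move=> x /eqP xH /eqP xL0; apply/eqP.
  rewrite -(mem_normal formK _ LA); suff : x \in (L :&: H)%VS by rewrite memv_cap => /andP[].
  by rewrite e memv_cap !(mem_normal formK) ?xH ?xL0 // deletion_subset.
exists s, t; split=> //; apply: contraNneq (deletion_neq LA') => t0.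
by apply/eqP/(normal_colinear hypA formK HA LA (c := s)); rewrite nE t0 scale0r addr0.
Qed.

(* Terao's divisibility: [alpha_H eta(alpha_0) - alpha_0 eta(alpha_H)] is
   divisible by every form of the pencil spanned by [alpha_H] and [alpha_0]. *)
Lemma pencil_divides eta L0 : logder A' eta -> L0 \in A' ->
  divides (\prod_(L <- A' | (L :&: H)%VS == (L0 :&: H)%VS) reduced_alpha L)
    (reduced_alpha L0 * rho (der_app eta (alpha H))).
Proof.
move=> /(logderP formK _ deletion_subset) eta_log L0A'.
set w := alpha H * der_app eta (alpha L0) - alpha L0 * der_app eta (alpha H).
have : divides (\prod_(L <- A' | (L :&: H)%VS == (L0 :&: H)%VS) alpha L) w.
  rewrite -big_filter; apply: prod_divides => [|L L'|L].
  - by rewrite filter_uniq ?fset_uniq.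
  - rewrite !mem_filter => /andP[_ LA'] /andP[_ LA2].
    by apply: (alpha_cancels hypA formK); apply: deletion_subset.
  rewrite mem_filter => /andP[/eqP LX LA'].
  have [s [t [nzt nE]]] := normal_in_pencil LA' L0A' LX.
  have aE : alpha L = s *: alpha H + t *: alpha L0.
    by rewrite /alpha_of nE raddfD /= !linearZ.
  apply: (dividesZ nzt).
  (* The terms in [s] cancel. Of the two products left, the first is divisible by [alpha L] because
     [eta] is logarithmic along [L]. *)
  have -> : t *: w = alpha H * der_app eta (alpha L) - alpha L * der_app eta (alpha H).
    rewrite aE der_app_linear der_appZ /w -!mul_mpolyC; ring.
  by apply: dividesB; [apply/divides_mull/eta_log | apply/divides_mulr/divides_refl].
(* Modulo [alpha H] only the second term of [w] survives, with a minus sign. *)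
case=> g /(congr1 rho); rewrite rmorphB !rmorphM /= reduce_alpha_self mul0r sub0r.
rewrite reduce_alpha rmorph_prod /= => e; exists (- rho g).
rewrite mulNr (eq_bigr (fun L => rho (alpha L))) => [|L _]; last by rewrite reduce_alpha.
by rewrite -e opprK.
Qed.

(** Group [A'] by trace on [H]. Each block is treated by [pencil_divides], as the form of its
    representative is a factor of [restriction_poly]; distinct blocks are coprime. *)
Lemma reduce_defining_poly_divides eta : logder A' eta ->
  divides (rho (defining_poly form A')) (restriction_poly * rho (der_app eta (alpha H))).
Proof.
move=> eta_log; rewrite reduce_defining_poly (partition_big_imfset _ (fun L => (L :&: H)%VS)) /=.
apply: prod_divides => [|X Y XA YA XY|X XA]; first exact: fset_uniq.
  rewrite -big_filter -[in X in cancels _ X]big_filter.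
  apply: cancels_prodl => [L|L].
    by rewrite mem_filter => /andP[_ /reduced_alpha_prime[]].
  rewrite mem_filter => /andP[/eqP LX LA']; apply: cancels_prod => L'.
  rewrite mem_filter => /andP[/eqP LY LA2].
  by apply: reduced_alpha_cancels; rewrite ?LX ?LY.
have [rA rX] := flat_repP XA.
rewrite /restriction_poly (big_fsetD1 X) //= mulrAC.
by have := pencil_divides eta_log rA; rewrite rX; apply: divides_mulr.
Qed.

(** * The additional generator and the final alternative *)

Section FreeBasis.
Variable theta : 'I_l -> 'rV[S]_l.
Variable d : 'I_l -> nat.
Hypothesis theta_log : forall i, logder A (theta i).
Hypothesis theta_homog : forall i, der_homog (d i) (theta i).
Hypothesis theta_gen : forall eta, logder A eta ->
  exists c : 'I_l -> S, eta = \sum_(i < l) c i *: theta i.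
Hypothesis theta_free : forall c : 'I_l -> S,
  \sum_(i < l) c i *: theta i = 0 -> forall i, c i = 0.

Local Notation M := (coef_mx theta).

(** Overwriting row [i] by a unit vector keeps the size [l], so that [det_divides_form] applies to
    the cofactor. *)
Definition minor_mx i : 'M[S]_l :=
  \matrix_(m, j) (if m == i then (j == k)%:R else M m j).
Definition minor i : S := \det (minor_mx i).

Lemma minorE i : minor i = cofactor M i k.
Proof.
rewrite /minor (expand_det_row _ i) (bigD1 k) //= big1 ?addr0 => [|j /negPf jk].
  rewrite mxE !eqxx mul1r /cofactor; congr (_ * \det _).
  by apply/matrixP => m j; rewrite !mxE eq_sym (negPf (neq_lift i m)).
by rewrite mxE eqxx jk mul0r.
Qed.

(** Row [k] of [\adj M *m M]. Since [alpha H] divides [\det M], the minors form a relation between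
    the [theta i] modulo [alpha H]. *)
Lemma sum_minor j : \sum_i minor i * theta i 0 j = (k == j)%:R * \det M.
Proof.
have /matrixP/(_ k j) := mul_adj_mx M; rewrite mxE [RHS]mxE mulr_natl => <-.
by apply: eq_bigr => i _; rewrite mxE minorE coef_mxE.
Qed.

(** Each row, paired with [reduced_normal L], is a multiple of [reduced_alpha L] modulo [alpha H]:
    row [i] gives 0, as [reduced_normal L] has no [k]-th coordinate, and the others are logarithmic
    along [H] and [L]. *)
Lemma restriction_poly_divides_minor i : divides restriction_poly (rho (minor i)).
Proof.
apply: prod_divides => [|X Y XA YA XY|X XA]; first exact: fset_uniq.
  have [rX eX] := flat_repP XA; have [rY eY] := flat_repP YA.
  by apply: reduced_alpha_cancels; rewrite ?eX ?eY.
have [rX _] := flat_repP XA; move: (flat_rep X) rX => L LA'.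
rewrite /minor -det_map_mx; apply: (det_divides_form (reduced_normal_neq0 LA')) => m.
have [->|mi] := eqVneq m i.
  rewrite (bigD1 k) //= reduced_normal_k scale0r add0r big1 => [|j /negPf jk].
    exact: divides0.
  by rewrite !mxE eqxx jk rmorph0 scaler0.
have -> : \sum_j reduced_normal L 0 j *: map_mx rho (minor_mx i) m j
    = rho (der_app (theta m) (linear_form (reduced_normal L))).
  rewrite der_app_linear_form linear_sum; apply: eq_bigr => j _ /=.
  by rewrite linearZ /= [map_mx _ _ _ _]mxE [minor_mx _ _ _]mxE (negPf mi) coef_mxE.
rewrite /reduced_normal addrC -scaleNr linearP /= der_app_linear linearP /=.
have [g1 ->] := theta_alpha formK theta_log m HA.
have [g2 ->] := theta_alpha formK theta_log m (deletion_subset LA').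
rewrite !rmorphM /= reduce_alpha_self reduce_alpha mulr0 scaler0 add0r.
exact/divides_mull/divides_refl.
Qed.

Lemma der_app_alphaH i : exists g, der_app (theta i) (alpha H) = g * alpha H.
Proof. exact: (theta_alpha formK theta_log i HA). Qed.

Lemma dhomog_minor i :
  minor i \is (\sum_(j < l) (if j == i then 0 else d j))%N.-homog.
Proof.
apply: dhomog_det => m j; rewrite mxE; case: eqP => _; last first.
  by rewrite coef_mxE; apply: theta_homog.
by case: eqP => _; [apply: dhomog1 | apply: dhomog0].
Qed.

(** Compare degrees in Saito's formula. *)
Lemma sum_exponents : (\sum_i d i)%N = #|` A|.
Proof.
have [|c nzc detE] := saito hypA formK theta_log theta_gen.
  by apply/fset0Pn; exists H.
have nzQ := defining_poly_neq0 hypA formK (fun _ => id).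
have nzdet : \det M != 0 by rewrite detE scaler_eq0 negb_or nzc nzQ.
apply: (dhomog_uniq nzdet); first by apply: dhomog_det => i j; rewrite coef_mxE; apply: theta_homog.
by rewrite detE rpredZ // dhomog_defining_poly.
Qed.

(** Makes the truncated subtraction in the level exact. *)
Lemma card_restriction_le : (#|` A''| <= #|` A'|)%N.
Proof. exact: leq_imfset_card. Qed.

Local Notation e := (#|` A'| - #|` A''|)%N.

Lemma deletion_generator : exists (v : 'I_l -> S) (phi : 'rV[S]_l),
  [/\ \sum_i v i *: theta i = alpha H *: phi,
      forall i m, m \in msupp (v i) -> (mdeg m + d i)%N = e.+1,
      der_homog e phi, logder A' phi &
      ~ divides (alpha H) (der_app phi (alpha H)) /\
      forall eta, logder A' eta -> exists s, logder A (eta - s *: phi)].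
Proof.
have [v vE] := fin_all_exists restriction_poly_divides_minor.
have [g gE] := fin_all_exists der_app_alphaH.
have nzR := restriction_poly_neq0.
have primeH := alpha_prime hypA formK HA; have [nzH _ dvdH] := primeH.
have rho0 p : rho p = 0 <-> divides (alpha H) p by apply: reduce_eq0.
have [|c nzc detE] := saito hypA formK theta_log theta_gen.
  by apply/fset0Pn; exists H.
have AE : defining_poly form A = alpha H * defining_poly form A'.
  exact: defining_polyD1.
have vR i : rho (v i) * restriction_poly = rho (minor i).
  by rewrite -reduce_restriction_poly -rmorphM /= -vE reduce_idem.
(* After multiplication by [restriction_poly], the sum becomes that of [sum_minor] modulo [alpha H],
   which vanishes there. *)
have phi_ex j : exists f, \sum_i v i * theta i 0 j = f * alpha H.
  apply/rho0/(mulIf nzR); rewrite mul0r rmorph_sum mulr_suml.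
  under eq_bigr do rewrite rmorphM mulrAC vR -rmorphM.
  rewrite -rmorph_sum sum_minor; apply/rho0/divides_mull.
  by rewrite detE AE; apply/divides_scale/divides_mulr/divides_refl.
have [f fE] := fin_all_exists phi_ex; pose phi : 'rV[S]_l := \row_j f j.
have phiE : \sum_i v i *: theta i = alpha H *: phi.
  apply/rowP => j; rewrite summxE !mxE mulrC -fE.
  by apply: eq_bigr => i _; rewrite mxE.
(* The minor has degree [|A| - d i] and [restriction_poly] has degree [|A''|]; with [|A| = |A'| + 1]
   this leaves [e + 1 - d i] for [v i]. *)
have v_deg i m : m \in msupp (v i) -> (mdeg m + d i)%N = e.+1.
  move=> mv; have hvR : v i * restriction_poly
      \is (\sum_(j < l) (if j == i then 0 else d j))%N.-homog.
    by rewrite -vE; apply/dhomog_reduce/dhomog_minor.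
  have e1 := homog_factor nzR dhomog_restriction_poly hvR mv.
  have e2 : (d i + \sum_(j < l) (if j == i then 0 else d j))%N = #|` A|.
    rewrite -sum_exponents (bigD1 i) //= [RHS](bigD1 i) //= eqxx add0n.
    by congr addn; apply: eq_bigr => j /negPf->.
  have := card_restriction_le; move: e1 e2; rewrite (cardfsD1 H A) HA -/A'.
  lia.
have v_phi i j : v i * theta i 0 j \is (e.+1).-homog.
  have [->|nzv] := eqVneq (v i) 0; first by rewrite mul0r dhomog0.
  rewrite -(v_deg i _ (mlead_supp nzv)); apply: dhomogM (theta_homog i j).
  by apply/dhomogP => m /v_deg; rewrite -(v_deg i _ (mlead_supp nzv)) => /addIn.
have phi_log : logder A' phi.
  apply/(logderP formK _ deletion_subset) => L LA'; have LA := deletion_subset LA'.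
  have LH := deletion_neq LA'.
  apply: (alpha_cancels hypA formK LA HA LH).
  rewrite -der_appZl -phiE der_app_sum; apply: divides_sum => i _.
  by rewrite der_appZl; apply/divides_mull/(theta_alpha formK theta_log i LA).
have phiH : der_app phi (alpha H) = \sum_i v i * g i.
  apply: (mulfI nzH); rewrite -der_appZl -phiE der_app_sum mulr_sumr.
  by apply: eq_bigr => i _; rewrite der_appZl gE; ring.
(* Pairing [sum_minor] with the form of [H] leaves [normal H 0 k * \det M], and [c] is Saito's
   constant. *)
pose b := normal H 0 k * c; have nzb : b != 0 by rewrite mulf_neq0.
have minor_g : \sum_i minor i * g i = b *: defining_poly form A'.
  apply: (mulfI nzH); rewrite -scalerAr -AE -scalerA -detE mulr_sumr.
  under eq_bigr do rewrite mulrCA [_ * g _]mulrC -gE der_app_linear_form mulr_sumr.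
  rewrite exchange_big (bigD1 k) //= [X in _ + X]big1 ?addr0 => [|j jk].
    by under eq_bigr do rewrite -scalerAr; rewrite -scaler_sumr sum_minor eqxx mul1r.
  under eq_bigr do rewrite -scalerAr.
  by rewrite -scaler_sumr sum_minor eq_sym (negPf jk) mul0r scaler0.
have phiR : restriction_poly * rho (der_app phi (alpha H)) =
    b *: rho (defining_poly form A').
  rewrite -linearZ -minor_g phiH !rmorph_sum mulr_sumr; apply: eq_bigr => i _.
  by rewrite !rmorphM mulrA [_ * rho (v i)]mulrC vR.
exists v, phi; split=> //; last split.
- move=> j; apply: (dhomog_factor nzH (dhomog_linear_form _)).
  by rewrite addn1 mxE -fE; apply: rpred_sum => i _; apply: v_phi.
- move=> /rho0 r0; move: phiR; rewrite r0 mulr0 => /esym/eqP.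
  rewrite scaler_eq0 (negPf nzb) reduce_defining_poly /=; apply/negP.
  rewrite prodf_seq_neq0; apply/allP => L /reduced_alpha_prime[] //.
move=> eta eta_log; have [t tE] := reduce_defining_poly_divides eta_log.
(* By [phiR], [b^-1] turns [t * rho Q(A')] into a multiple of
   [restriction_poly * rho (phi (alpha H))]; then [restriction_poly] cancels. *)
exists (b^-1 *: t).
have etaR : rho (der_app eta (alpha H)) = (b^-1 *: t) * rho (der_app phi (alpha H)).
  apply: (mulfI nzR); rewrite tE mulrCA phiR -scalerAr -scalerAl scalerA mulfV //.
  by rewrite scale1r.
have appB p : der_app (eta - (b^-1 *: t) *: phi) p =
    der_app eta p - (b^-1 *: t) * der_app phi p.
  by rewrite der_appD -scaleNr der_appZl mulNr.
apply/(logderP formK _ (fun _ => id)) => L LA; rewrite appB.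
have [->|LH] := eqVneq L H.
  apply/rho0; rewrite rmorphB rmorphM /=.
  by have := congr1 rho etaR; rewrite rmorphM /= !(reduce_idem _ Hk) => <-; rewrite subrr.
have LA' : L \in A' by rewrite !inE LH.
have /(logderP formK _ deletion_subset)/(_ L LA') := eta_log.
have /(logderP formK _ deletion_subset)/(_ L LA') := phi_log.
by move=> h1 h2; apply: dividesB h2 _; apply: divides_mull.
Qed.

Lemma deletion_free_or_spog :
  free_arrangement A' \/ strictly_plus_one_generated A' d e.
Proof.
have [v [phi [phiE v_deg phi_homog phi_log [ndvd phi_gen]]]] := deletion_generator.
have primeH := alpha_prime hypA formK HA; have [nzH _ dvdH] := primeH.
have theta_log' i : logder A' (theta i).
  apply/(logderP formK _ deletion_subset) => L /deletion_subset.
  exact: (theta_alpha formK theta_log).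
have gen eta : logder A' eta -> exists (c : 'I_l -> S) (b : S),
    eta = \sum_(i < l) c i *: theta i + b *: phi.
  case/phi_gen => s /theta_gen[c cE]; exists c, s.
  by rewrite -cE subrK.
have rel (c : 'I_l -> S) (b : S) : \sum_(i < l) c i *: theta i + b *: phi = 0 <->
    exists s : S, (forall i, c i = s * - v i) /\ b = s * alpha H.
  split=> [e0|[s [cE ->]]]; last first.
    under eq_bigr do rewrite cE mulrN scaleNr -scalerA.
    by rewrite sumrN -scaler_sumr phiE scalerA addrC subrr.
  (* Multiply the relation by [alpha H], replace [alpha H *: phi] by the sum of the
     [v i *: theta i], and use freeness. *)
  have cb i : alpha H * c i + b * v i = 0.
    move: i; apply: theta_free.
    under eq_bigr do rewrite scalerDl -!scalerA.
    rewrite big_split -!scaler_sumr phiE /= scalerA [b * _]mulrC -scalerA -scalerDr.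
    by rewrite e0 scaler0.
  (* By [cb], [alpha H] divides every [b * v i], hence [b * phi (alpha H)]; it is prime and does not
     divide [phi (alpha H)]. *)
  have [s bE] : divides (alpha H) b.
    suff : divides (alpha H) (b * der_app phi (alpha H)).
      by case/dvdH => // /ndvd.
    have [g gE] := fin_all_exists der_app_alphaH.
    have -> : der_app phi (alpha H) = \sum_i v i * g i.
      apply: (mulfI nzH); rewrite -der_appZl -phiE der_app_sum mulr_sumr.
      by apply: eq_bigr => i _; rewrite der_appZl gE; ring.
    rewrite mulr_sumr; apply: divides_sum => i _; rewrite mulrA; apply: divides_mulr.
    by exists (- c i); rewrite mulNr [c i * _]mulrC; apply/eqP; rewrite -addr_eq0 addrC cb.
  exists s; split=> // i; apply: (mulfI nzH); apply/eqP.
  by rewrite -subr_eq0 -(cb i) bE; apply/eqP; ring.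
have [/existsP[i vi0]|/existsPn v0] := boolP [exists i, (v i)@_0%MM != 0].
  left; pose x := (v i)@_0%MM; have nzx : x != 0 by [].
  (* A constant term forces [d i = e + 1], and then [v i] is homogeneous of degree 0. *)
  have di : d i = e.+1 by rewrite -(v_deg i 0%MM) ?mcoeff_msupp // mdeg0.
  have vi : v i = x%:MP.
    apply/mpolyP => m; rewrite mcoeffC; have [<-|m0] := eqVneq 0%MM m.
      by rewrite mulr1.
    rewrite mulr0; apply/eqP/negPn/negP => vm; case/eqP: m0.
    apply/esym/eqP; rewrite -mdeg_eq0 -(eqn_add2r (d i)) (v_deg i m) ?mcoeff_msupp //.
    by rewrite di.
  exists (fun j => if j == i then e else d j).
  exists (fun j => if j == i then phi else theta j); split.
  - by move=> j; case: eqP.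
  - by move=> j; case: eqP => // _; apply: theta_homog.
  - move=> eta /gen[c [b ->]].
    (* Chosen so that [y * v i = c i]: subtracting [y] times the relation removes [theta i]. *)
    pose y := x^-1 *: c i.
    exists (fun j => if j == i then b + y * alpha H else c j - y * v j).
    have -> : \sum_j c j *: theta j + b *: phi =
        \sum_j (c j - y * v j) *: theta j + (b + y * alpha H) *: phi.
      under [in RHS]eq_bigr do rewrite scalerBl -scalerA.
      rewrite sumrB -scaler_sumr phiE scalerDl -[(y * _) *: _]scalerA.
      by rewrite [in RHS]addrCA [in RHS]subrK addrC.
    have yv : y * v i = c i.
      by rewrite vi mulrC mul_mpolyC scalerA mulfV // scale1r.
    rewrite (bigD1 i) //= [in RHS](bigD1 i) //= eqxx yv subrr scale0r add0r addrC.
    by congr (_ + _); apply: eq_bigr => j /negPf->.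
  - move=> c; rewrite (bigD1 i) //= eqxx => c0.
    (* A relation between the new generators has coefficient 0 at [theta i], so [s * v i = 0] with
       [v i] a nonzero constant. *)
    have /rel[s [cs sb]] : \sum_j (if j == i then 0 else c j) *: theta j + c i *: phi = 0.
      rewrite (bigD1 i) //= eqxx scale0r add0r addrC -[RHS]c0; congr (_ + _).
      by apply: eq_bigr => j /negPf->.
    have s0 : s = 0.
      have /esym/eqP := cs i; rewrite eqxx mulrN oppr_eq0 mulf_eq0 vi mpolyC_eq0.
      by rewrite (negPf nzx) orbF => /eqP.
    move=> j; have := cs j; case: eqP => [-> _|_ ->]; last by rewrite s0 mul0r.
    by rewrite sb s0 mul0r.
(* No [v i] has a constant term, so the resolution given by [rel] is minimal. *)
right; exists theta, phi, (fun i => - v i), (form H); split; last first.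
  move=> f0; have := normal_neq0 hypA formK HA; rewrite /normal_of f0 => /eqP; apply.
  by apply/rowP => i; rewrite !mxE lfunE.
split=> //.
- by move=> i m; rewrite (perm_mem (msuppN _)); apply: v_deg.
- move=> c b; rewrite form_polyE; exact: rel.
- by move=> s _ /eqP; rewrite form_polyE mulf_eq0 (negPf nzH) orbF => /eqP.
- by move=> i; rewrite mcoeffN; apply/eqP; rewrite oppr_eq0; apply/negPn/v0.
Qed.

End FreeBasis.

End Deletion.

Theorem theorem1p4 (K : fieldType) (l : nat)
    (A : {fset {vspace 'rV[K]_l}}) (d : 'I_l -> nat) (H : {vspace 'rV[K]_l}) :
  arrangement A -> essential A -> free_with_exp A d -> H \in A ->
  free_arrangement (deletion A H) \/
  strictly_plus_one_generated (deletion A H) d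
    (#|` deletion A H| - #|` restriction A H|)%N.
Proof.
move=> hypA _ [theta [theta_log theta_homog theta_gen theta_free]] HA.
have [f fP] := fin_all_exists (fun x : A => hyperplane_form (hypA (val x) (valP x))).
(* The zero form is a default value outside [A]. *)
pose form L := if insub L is Some x then f x else 0%R.
have formK : {in A, forall L, lker (form L) = L}.
  by move=> L LA; rewrite /form; case: insubP => [x _ <-|]; [exact: fP | rewrite LA].
have [k Hk] := row_neq0_ex (normal_neq0 hypA formK HA).
exact: (deletion_free_or_spog hypA formK HA Hk).
Qed.
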